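(* Let $n\ge 1$, $r,z\ge0$ be integers with $k:=n-r-z\ge1$, and let $q>n(k+r)$ be a prime power. Then the linear encoding scheme over $\mathbb{F}_q$ with encoding matrix $G=TV$ described in the context is a rate-optimal $(n,k,r,z)_{\mathcal{Q}}$ secret sharing scheme with $\mathcal{Q}=\mathbb{F}_q^{k+r}$. The scheme achieves the optimal decoding bandwidth when $d$ nodes participate in decoding, for $d=n$ and for $d=n-r$.
   Context: Notation: $[n]=\{1,\dots,n\}$; $\bm{c}_I=(c_i)_{i\in I}$; $H$ is Shannon entropy, all logarithms are to base $Q=|\mathcal{Q}|$. An $(n,k,r,z)_{\mathcal{Q}}$ secret sharing scheme consists of a randomized encoding function $F$ mapping a secret $\bm{m}\in\mathcal{Q}^k$ (uniformly distributed, independent of the internal randomness of $F$) to shares $\bm{c}=(c_1,\dots,c_n)\in\mathcal{Q}^n$ such that (Reliability) $H(\bm{m}\mid\bm{c}_I)=0$ for all $I\subset[n]$, $|I|=n-r$, and (Secrecy) $H(\bm{m}\mid\bm{c}_I)=H(\bm{m})$ for all $I\subset[n]$, $|I|=z$. It is rate-optimal if $k=n-r-z$ (the largest possible value of $k$). Optimal decoding bandwidth: for $I\subset[n]$ with $|I|\ge n-r$, preprocessing functions are maps $E_{I,i}:\mathcal{Q}\to\mathcal{S}_{I,i}$ ($i\in I$, $|\mathcal{S}_{I,i}|\le|\mathcal{Q}|$) and a decoding function is a map $D_I:\prod_{i\in I}\mathcal{S}_{I,i}\to\mathcal{Q}^k$ with $D_I\big((E_{I,i}(c_i))_{i\in I}\big)=\bm{m}$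 always. The communication overhead is $\mathrm{CO}(I)=\sum_{i\in I}\log|\mathcal{S}_{I,i}|-k$ and the decoding bandwidth is $\mathrm{CO}(I)+k$. For every scheme $\mathrm{CO}(I)\ge kz/(|I|-z)$; the scheme achieves the optimal decoding bandwidth when $d$ nodes participate if for every $I\subset[n]$ with $|I|=d$ there are preprocessing and decoding functions with $\mathrm{CO}(I)=\frac{kz}{d-z}$. The encoding scheme. The $j$-th share is $c_j=(c_{1,j},\dots,c_{k+r,j})\in\mathbb{F}_q^{k+r}$, $j=1,\dots,n$. The secret, $k$ symbols over $\mathcal{Q}$, is written as $(m_1,\dots,m_{k(k+r)})\in\mathbb{F}_q^{k(k+r)}$. Keys $\bm{k}=(k_1,\dots,k_{kz})\in\mathbb{F}_q^{kz}$ and $\bm{k}'=(k_1',\dots,k'_{rz})\in\mathbb{F}_q^{rz}$ are uniform, independent of each other and of $\bm{m}$. Encoding is $$(c_{1,1},\dots,c_{1,n},\dots,c_{k+r,1},\dots,c_{k+r,n})=(m_1,\dots,m_{k(k+r)},k_1,\dots,k_{kz},k'_1,\dots,k'_{rz})\,G,$$ where $G$ is the $(nk+rz)\times n(k+r)$ matrix $G=TV$ defined as follows. Let $\alpha_1,\dots,\alpha_{n(k+r)}$ be distinct non-zero elements of $\mathbb{F}_q$ and $V=(\alpha_j^{i-1})_{1\le i\le nk+rz,\,1\le j\le n(k+r)}$. Let $\bm{f}_i[x]=x^{i-1}$ for $i=1,\dots,kn$ and $\bm{f}_{kn+i}[x]=x^{i-1}\prod_{j=1}^{kn}(x-\alpha_j)$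 for $i=1,\dots,rz$. $T$ is the square matrix of size $kn+rz$ whose $i$-th row is the coefficient vector $(f_{i,0},f_{i,1},\dots,f_{i,kn+rz-1})$ of $\bm{f}_i[x]=\sum_l f_{i,l}x^l$. *)

(* Defs.v *)
From HB Require Import structures.
From mathcomp Require Import all_boot all_order all_algebra.
From mathcomp Require Import reals exp.

Set Implicit Arguments.
Unset Strict Implicit.
Unset Printing Implicit Defensive.

Import Order.TTheory GRing.Theory Num.Theory.
Local Open Scope ring_scope.

Section Entropy.
Variables (R : realType) (W A B : finType).

Definition logb (b x : R) : R := ln x / ln b.

Definition pmf_of (P : W -> R) (X : W -> A) (a : A) : R :=
  \sum_(w | X w == a) P w.

(* The convention 0 log 0 = 0 holds because the factor 0 absorbs [ln 0]. *)
Definition entropy (b : R) (P : W -> R) (X : W -> A) : R :=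
  - \sum_(a : A) pmf_of P X a * logb b (pmf_of P X a).

Definition cond_pmf (P : W -> R) (Y : W -> B) (y : B) (w : W) : R :=
  if Y w == y then P w / (\sum_(w' | Y w' == y) P w') else 0.

(* H(X | Y) = sum_y P(Y = y) H(X | Y = y); a value y of probability 0
   contributes 0. *)
Definition cond_entropy (b : R) (P : W -> R) (X : W -> A) (Y : W -> B) : R :=
  \sum_(y : B) (\sum_(w | Y w == y) P w) * entropy b (cond_pmf P Y y) X.

End Entropy.

(* A randomized encoding of k symbols over Q into n symbols over Q: the
   internal randomness is an element of [key] drawn according to [keyP]. *)
Record scheme (R : realType) (Q : finType) (n k : nat) := Scheme {
  key : finType;
  keyP : key -> R;
  keyP_ge0 : forall w, 0 <= keyP w;
  keyP_sum1 : \sum_w keyP w = 1;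
  encode : {ffun 'I_k -> Q} -> key -> {ffun 'I_n -> Q}
}.

Section SecretSharing.
Variables (R : realType) (Q : finType) (n k : nat) (S : scheme R Q n k).
Implicit Types I : {set 'I_n}.

(* The secret is uniform on Q^k and independent of the randomness. *)
Definition jointP (w : {ffun 'I_k -> Q} * key S) : R :=
  (#|{ffun 'I_k -> Q}|%:R)^-1 * keyP w.2.

Definition secret_rv (w : {ffun 'I_k -> Q} * key S) : {ffun 'I_k -> Q} := w.1.

Definition shares_rv I (w : {ffun 'I_k -> Q} * key S) :
    {ffun {i : 'I_n | i \in I} -> Q} :=
  [ffun i => encode w.1 w.2 (val i)].

Definition H_secret : R := entropy (#|Q|%:R) jointP secret_rv.

Definition H_secret_given I : R :=
  cond_entropy (#|Q|%:R) jointP secret_rv (shares_rv I).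

Definition reliable (r : nat) : Prop :=
  forall I, #|I| = (n - r)%N -> H_secret_given I = 0.

Definition secretive (z : nat) : Prop :=
  forall I, #|I| = z -> H_secret_given I = H_secret.

Definition secret_sharing (r z : nat) : Prop := reliable r /\ secretive z.

(* k = n - r - z, as an equation between integers. *)
Definition rate_optimal (r z : nat) : Prop :=
  secret_sharing r z /\ k%:Z = n%:Z - r%:Z - z%:Z.

Record decoder I := Decoder {
  msg : {i : 'I_n | i \in I} -> finType;
  preproc : forall i : {i : 'I_n | i \in I}, Q -> msg i;
  decode : (forall i : {i : 'I_n | i \in I}, msg i) -> {ffun 'I_k -> Q};
  card_msg : forall i, (#|msg i| <= #|Q|)%N;
  decodeK : forall (m : {ffun 'I_k -> Q}) (w : key S), 0 < keyP w ->
    decode (fun i => preproc i (encode m w (val i))) = m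
}.

Definition comm_overhead I (D : decoder I) : R :=
  \sum_(i : {i : 'I_n | i \in I}) logb (#|Q|%:R) (#|msg D i|%:R) - k%:R.

Definition optimal_decoding_bandwidth (z d : nat) : Prop :=
  forall I, #|I| = d ->
    exists D : decoder I, comm_overhead D = (k * z)%:R / (d%:R - z%:R).

End SecretSharing.

Lemma index_allpairs (T1 T2 : eqType) (s : seq T1) (t : seq T2) x y :
  x \in s -> y \in t ->
  index (x, y) [seq (a, b) | a <- s, b <- t]
    = (index x s * size t + index y t)%N.
Proof.
move=> + yt; elim: s => [//|a s IH]; rewrite inE /= index_cat.
have [-> _|nax /= xs] := eqVneq x a.
  by rewrite map_f // index_map // => b c [].
have /negPf -> : (x, y) \notin [seq (a, b) | b <- t].
  by apply/mapP => -[b _ [xa _]]; rewrite xa eqxx in nax.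
by rewrite IH // size_map mulSn addnA.
Qed.

Lemma val_mxvec_index (m n : nat) (i : 'I_m) (j : 'I_n) :
  mxvec_index i j = (i * n + j)%N :> nat.
Proof.
rewrite /mxvec_index /= /enum_rank [enum_rank_in]unlock /= insubdK; last first.
  by rewrite unfold_in cardE index_mem mem_enum.
have -> : enum {: 'I_m * 'I_n} = [seq (a, b) | a <- enum 'I_m, b <- enum 'I_n].
  by rewrite enumT unlock.
by rewrite index_allpairs ?mem_enum // size_enum_ord !index_enum_ord.
Qed.

Section Construction.
Variables (F : finFieldType) (n k r z : nat).
Variable alpha : 'I_((k + r) * n) -> F.

(* Indices start at 0: [fpoly i] is f_(i+1). *)
Definition fpoly (i : nat) : {poly F} :=
  if (i < k * n)%N then 'X^i
  else 'X^(i - k * n) *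
       \prod_(j < (k + r) * n | (j < k * n)%N) ('X - (alpha j)%:P).

Definition Tmx : 'M[F]_(k * n + r * z) :=
  \matrix_(i < k * n + r * z, l < k * n + r * z) (fpoly i)`_l.

Definition Vmx : 'M[F]_(k * n + r * z, (k + r) * n) :=
  \matrix_(i < k * n + r * z, j < (k + r) * n) alpha j ^+ i.

Definition Gmx : 'M[F]_(k * n + r * z, (k + r) * n) := Tmx *m Vmx.

Hypothesis hn : n = (k + r + z)%N.

Lemma input_size : (k * (k + r) + k * z + r * z = k * n + r * z)%N.
Proof. by rewrite hn -mulnDr. Qed.

(* (m_1, .., m_(k(k+r)), k_1, .., k_(kz), k'_1, .., k'_(rz)); the secret is the
   concatenation of its k symbols, each a vector of length k + r. *)
Definition input (m : {ffun 'I_k -> 'rV[F]_(k + r)})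
    (kk : 'rV[F]_(k * z) * 'rV[F]_(r * z)) : 'rV[F]_(k * n + r * z) :=
  castmx (erefl 1, input_size)
    (row_mx (row_mx (mxvec (\matrix_(i < k) m i)) kk.1) kk.2).

(* [vec_mx] cuts the codeword (c_(1,1), .., c_(1,n), .., c_(k+r,n)) into k + r
   rows of length n (see [val_mxvec_index]); share j is column j of the
   resulting matrix, stored as a row vector. *)
Definition share_encode (m : {ffun 'I_k -> 'rV[F]_(k + r)})
    (kk : 'rV[F]_(k * z) * 'rV[F]_(r * z)) : {ffun 'I_n -> 'rV[F]_(k + r)} :=
  [ffun j => (col j (vec_mx (input m kk *m Gmx) : 'M[F]_(k + r, n)))^T].

Variable R : realType.

(* Uniform on the product: the two keys are uniform and independent. *)
Let K : finType := ('rV[F]_(k * z) * 'rV[F]_(r * z))%type.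

Lemma unif_ge0 (w : K) : 0 <= (#|K|%:R)^-1 :> R.
Proof. by rewrite invr_ge0 ler0n. Qed.

Lemma unif_sum1 : \sum_(w : K) (#|K|%:R)^-1 = 1 :> R.
Proof.
rewrite sumr_const -[LHS]mulr_natl divff // pnatr_eq0 -lt0n.
by apply/card_gt0P; exists (0, 0).
Qed.

Definition linear_scheme : scheme R ('rV[F]_(k + r)) n k :=
  @Scheme R _ n k K (fun _ => (#|K|%:R)^-1) unif_ge0 unif_sum1 share_encode.

End Construction.

(* Main.v *)
(* A codeword lists the values of g + h P, where P vanishes exactly at the
   points of the first k rows, deg g < kn (coefficients: message, then k) and
   deg h < rz (coefficients k').  Everything is root counting:
   - n - r full shares give kn + rz points, hence the whole polynomial;
   - the first k rows of all n shares give g at kn points, hence the message,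
     while each node sends only k of its k + r symbols;
   - for a fixed message, the (k + r) z symbols of z shares determine the
     (k + r) z key symbols, so they are uniform whatever the message is. *)
Require Import Defs.
From mathcomp Require Import all_boot all_order all_algebra.
From mathcomp Require Import reals exp.
Set Implicit Arguments.
Unset Strict Implicit.
Unset Printing Implicit Defensive.
Import Order.TTheory GRing.Theory Num.Theory.
Local Open Scope ring_scope.

Lemma card_ord_lt (m n : nat) :
  (m <= n)%N -> #|[set i : 'I_n | (i < m)%N]| = m.
Proof.
move=> le_mn.
by rewrite -sum1dep_card (big_ord_narrow le_mn) sum1_card card_ord.
Qed.

Lemma horner_rVpoly (A : nzRingType) (d : nat) (v : 'rV[A]_d) (x : A) :
  (rVpoly v).[x] = \sum_i v 0 i * x ^+ i.
Proof.
rewrite (horner_coef_wide _ (size_poly _ _)).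
by apply: eq_bigr => i _; rewrite coef_rVpoly_ord.
Qed.

Lemma rVpoly_eq0 (A : nzRingType) (d : nat) (v : 'rV[A]_d) :
  rVpoly v = 0 -> v = 0.
Proof. by move=> v0; apply: (can_inj rVpolyK); rewrite v0 linear0. Qed.

(** * Codewords as values of one polynomial, and root counting *)

Section Codewords.
Variables (F : finFieldType) (n k r z : nat) (alpha : 'I_((k + r) * n) -> F).
Implicit Types (u : 'rV[F]_(k * n + r * z)) (I : {set 'I_n}).

Let P : {poly F} := \prod_(j < (k + r) * n | (j < k * n)%N) ('X - (alpha j)%:P).

Definition codepoly u : {poly F} := rVpoly (lsubmx u) + rVpoly (rsubmx u) * P.

Lemma size_vanishing : size P = (k * n).+1.
Proof.
rewrite /P -big_filter size_prod_XsubC size_filter -sum1_count.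
have le_kn : (k * n <= (k + r) * n)%N by rewrite leq_mul2r leq_addr orbT.
by rewrite (big_ord_narrow le_kn) sum1_card card_ord.
Qed.

Lemma size_fpoly i : (i < k * n + r * z)%N ->
  (size (fpoly alpha i) <= k * n + r * z)%N.
Proof.
rewrite /fpoly; case: ifPn => [_ ilt|]; first by rewrite size_polyXn.
rewrite -leqNgt => le_kn_i ilt; apply: leq_trans (size_polyMleq _ _) _.
by rewrite size_vanishing size_polyXn addnS /= addSn subnK.
Qed.

(** A row of [Tmx] times a column of [Vmx] evaluates [fpoly] at a point; splitting the sum over rows
    at [k * n] separates g from h P. *)
Lemma encode_mxE u j : (u *m Gmx z alpha) 0 j = (codepoly u).[alpha j].
Proof.
have TVE i : (Tmx z alpha *m Vmx z alpha) i j = (fpoly alpha i).[alpha j].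
  rewrite mxE (horner_coef_wide _ (size_fpoly (ltn_ord i))).
  by apply: eq_bigr => l _; rewrite !mxE.
rewrite mxE big_split_ord /= /codepoly hornerD hornerM !horner_rVpoly.
rewrite mulr_suml; congr (_ + _); apply: eq_bigr => i _.
  by rewrite TVE mxE /fpoly /= ltn_ord hornerXn.
rewrite TVE mxE /fpoly /= ltnNge leq_addr /= addKn -/P hornerM hornerXn.
by rewrite mulrA.
Qed.

Lemma mxvec_index_lt (i : 'I_(k + r)) (j : 'I_n) :
  (mxvec_index i j < k * n)%N = (i < k)%N.
Proof.
rewrite val_mxvec_index; have lt_jn := ltn_ord j.
have n_gt0 : (0 < n)%N by apply: leq_ltn_trans lt_jn.
by rewrite -ltn_divLR // divnMDl // divn_small // addn0.
Qed.

Hypothesis alpha_inj : injective alpha.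

(** Distinct positions give distinct points, since [alpha] and [mxvec_index] are both injective. *)
Lemma pair_roots_poly_eq0 (p : {poly F}) (A : {set 'I_(k + r) * 'I_n}) :
  (forall i j, (i, j) \in A -> root p (alpha (mxvec_index i j))) ->
  (size p <= #|A|)%N -> p = 0.
Proof.
move=> rootA; rewrite cardE -(size_map (alpha \o uncurry (@mxvec_index _ _))).
apply: roots_geq_poly_eq0.
  by apply/allP => x /mapP[[i j]]; rewrite mem_enum => /rootA ? ->.
rewrite map_inj_uniq ?enum_uniq //; apply: inj_comp => //.
have [g gK _] := curry_mxvec_bij (k + r) n.
by apply: (can_inj (g := g)) => x; apply: gK.
Qed.

Lemma root_vanishing (i : 'I_(k + r)) (j : 'I_n) :
  root P (alpha (mxvec_index i j)) = (i < k)%N.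
Proof.
rewrite -(mxvec_index_lt i j) /P /root horner_prod; apply/idP/idP.
  rewrite prodf_seq_eq0 => /hasP[l _ /andP[lt_l]].
  by rewrite hornerXsubC subr_eq0 => /eqP /alpha_inj ->.
by move=> lt_kn; rewrite (bigD1 (mxvec_index i j)) //= hornerXsubC subrr mul0r.
Qed.

Lemma codepoly_low u (i : 'I_(k + r)) (j : 'I_n) : (i < k)%N ->
  (codepoly u).[alpha (mxvec_index i j)]
    = (rVpoly (lsubmx u)).[alpha (mxvec_index i j)].
Proof.
move=> lt_ik; rewrite /codepoly hornerD hornerM.
by have := root_vanishing i j; rewrite lt_ik => /eqP ->; rewrite mulr0 addr0.
Qed.

Lemma codeword_low_eq0 u :
  (forall (i : 'I_(k + r)) j, (i < k)%N ->
     (codepoly u).[alpha (mxvec_index i j)] = 0) ->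
  lsubmx u = 0.
Proof.
move=> u0; apply: rVpoly_eq0.
apply: (pair_roots_poly_eq0
  (A := setX [set i : 'I_(k + r) | (i < k)%N] [set: 'I_n])).
  by move=> i j; rewrite !inE andbT /root => lt_ik; rewrite -codepoly_low // u0.
by rewrite cardsX card_ord_lt ?leq_addr // cardsT card_ord size_poly.
Qed.

Hypothesis hn : n = (k + r + z)%N.

Lemma codeword_all_eq0 u I : #|I| = (n - r)%N ->
  (forall i j, j \in I -> (codepoly u).[alpha (mxvec_index i j)] = 0) ->
  lsubmx u = 0.
Proof.
move=> cardI u0; suff p0 : codepoly u = 0.
  by apply: codeword_low_eq0 => i j _; rewrite p0 horner0.
apply: (pair_roots_poly_eq0 (A := setX [set: 'I_(k + r)] I)).
  by move=> i j; rewrite !inE /= => jI; rewrite /root u0.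
rewrite cardsX cardsT card_ord cardI.
(* As n - r = k + z, the number of points equals the size bound on [codepoly u]. *)
have -> : ((k + r) * (n - r) = k * n + r * z)%N.
  by rewrite hn addnAC addnK !mulnDl !mulnDr addnA (mulnC r k) addnAC.
rewrite (leq_trans (size_polyD _ _)) // geq_max.
rewrite (leq_trans (size_poly _ _)) ?leq_addr //=.
rewrite (leq_trans (size_polyMleq _ _)) // size_vanishing addnS /= addnC.
rewrite leq_add2l.
exact: size_poly.
Qed.

Hypothesis alpha_neq0 : forall j, alpha j != 0.

(* The first k rows do not see k', and on them the message vanishes, so the
   keys k are determined by z shares; the remaining rows then determine k'. *)
Lemma codeword_keys_eq0 u I : #|I| = z ->
  (forall l : 'I_(k * n + r * z), (l < k * (k + r))%N -> u 0 l = 0) ->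
  (forall i j, j \in I -> (codepoly u).[alpha (mxvec_index i j)] = 0) ->
  u = 0.
Proof.
move=> cardI um0 u0.
have low0 : rVpoly (lsubmx u) = 0.
  set p := rVpoly _.
  (* The message fills the coefficients below degree [k * (k + r)], so [p] is that power of X times
     a polynomial formed by the kz keys. *)
  have take0 : take_poly (k * (k + r)) p = 0.
    apply/polyP => l; rewrite coef_take_poly coef0; case: ifP => // lt_l.
    have lt_kn : (l < k * n)%N.
      by rewrite (leq_trans lt_l) // hn leq_mul2l leq_addr orbT.
    by rewrite (coef_rVpoly_ord _ (Ordinal lt_kn)) mxE um0.
  rewrite -(poly_take_drop (k * (k + r)) p) take0 add0r.
  suff -> : drop_poly (k * (k + r)) p = 0 by rewrite mul0r.
  (* The points are non-zero, so the power of X cancels, leaving kz roots for size at most kz. *)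
  apply: (pair_roots_poly_eq0
    (A := setX [set i : 'I_(k + r) | (i < k)%N] I)).
    move=> i j; rewrite !inE /= => /andP[lt_ik jI].
    have := u0 i j jI; rewrite codepoly_low // -/p.
    rewrite -{1}(poly_take_drop (k * (k + r)) p) take0 add0r hornerM hornerXn.
    by move/eqP; rewrite mulf_eq0 expf_eq0 (negPf (alpha_neq0 _)) andbF orbF.
  rewrite cardsX card_ord_lt ?leq_addr // cardI size_drop_poly leq_subLR.
  by rewrite -mulnDr -hn size_poly.
have high0 : rVpoly (rsubmx u) = 0.
  (* [P] is non-zero outside the first [k] rows, so h inherits the rz roots there. *)
  apply: (pair_roots_poly_eq0
    (A := setX (~: [set i : 'I_(k + r) | (i < k)%N]) I)).
    move=> i j; rewrite !inE /= => /andP[nlt_ik jI].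
    have := u0 i j jI; rewrite /codepoly low0 add0r hornerM => /eqP.
    by rewrite mulf_eq0 [X in _ || X]root_vanishing (negPf nlt_ik) orbF.
  rewrite cardsX cardsCs setCK card_ord_lt ?leq_addr // card_ord addKn cardI.
  exact: size_poly.
by rewrite -[u]hsubmxK (rVpoly_eq0 low0) (rVpoly_eq0 high0) row_mx0.
Qed.

(** * From messages, keys and shares to differences of codewords *)

Implicit Types (m : {ffun 'I_k -> 'rV[F]_(k + r)})
  (w : 'rV[F]_(k * z) * 'rV[F]_(r * z)).

Lemma input_msg m w i j (l : 'I_(k * n + r * z)) :
  l = mxvec_index i j :> nat -> input hn m w 0 l = m i 0 j.
Proof.
move=> def_l; rewrite /input castmxE /=.
have -> : cast_ord (esym (input_size hn)) l
    = lshift _ (lshift _ (mxvec_index i j)) by apply: val_inj.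
by rewrite cast_ord_id !row_mxEl mxvecE mxE.
Qed.

Lemma input_same_msg m w w' (l : 'I_(k * n + r * z)) :
  (l < k * (k + r))%N -> input hn m w 0 l = input hn m w' 0 l.
Proof.
move=> lt_l; case def_l: _ / (mxvec_indexP (Ordinal lt_l)) => [i j].
have {}def_l : l = mxvec_index i j :> nat by rewrite -def_l.
by rewrite !(input_msg _ _ def_l).
Qed.

(** Since k(k+r) <= kn, the whole message lies in the left block, that is, in g. *)
Lemma input_msg_inj m m' w w' :
  lsubmx (input hn m w - input hn m' w') = 0 -> m = m'.
Proof.
move=> eq0; apply/ffunP => i; apply/rowP => j.
have lt_l : (mxvec_index i j < k * n)%N.
  by rewrite (leq_trans (ltn_ord _)) // hn leq_mul2l leq_addr orbT.
move/rowP/(_ (Ordinal lt_l))/eqP: eq0; rewrite linearB !mxE subr_eq0 => /eqP.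
by rewrite !(@input_msg _ _ i j).
Qed.

Lemma input_key_inj m : injective (input hn m).
Proof.
move=> [w1 w2] [w1' w2'] /(can_inj (castmxK _ _)) /eq_row_mx[].
by move=> /eq_row_mx[_ /= ->] /= ->.
Qed.

(** By linearity, two equal symbols give a root of the polynomial of the difference, so injectivity
    reduces to root counting. *)
Lemma share_encode_eq m m' w w' (i : 'I_(k + r)) (j : 'I_n) :
  share_encode alpha hn m w j 0 i = share_encode alpha hn m' w' j 0 i ->
  (codepoly (input hn m w - input hn m' w')).[alpha (mxvec_index i j)] = 0.
Proof.
rewrite !ffunE !mxE -encode_mxE mulmxBl => eq_c.
by rewrite !mxE eq_c subrr.
Qed.

End Codewords.

(** * Conditional entropy in the two extreme cases *)

Section Entropies.
Variables (R : realType) (W A B : finType) (b : R).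
Variables (P : W -> R) (X : W -> A) (Y : W -> B).

Lemma pmf_cond_pmf (a : A) (y : B) :
  pmf_of (cond_pmf P Y y) X a
    = (\sum_(w | (X w == a) && (Y w == y)) P w) / \sum_(w | Y w == y) P w.
Proof. by rewrite /pmf_of mulr_suml [RHS]big_mkcondr. Qed.

(** Given a value of [Y] of non-zero mass, [X] is a point mass, with only terms 1 log 1 and 0 log
    0. *)
Lemma cond_entropy_determined :
  (forall w w', Y w = Y w' -> X w = X w') -> cond_entropy b P X Y = 0.
Proof.
move=> detXY; apply: big1 => y _; set p := \sum_(w | _) _.
have [->|p_neq0] := eqVneq p 0; first by rewrite mul0r.
have [w0 /eqP Yw0|Y_neq] := pickP (fun w => Y w == y); last first.
  by rewrite /p big_pred0 ?eqxx in p_neq0.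
rewrite /entropy big1 ?oppr0 ?mulr0 // => a _; rewrite pmf_cond_pmf -/p.
have [<-|neq_a] := eqVneq (X w0) a.
  rewrite [X in X / p](_ : _ = p) ?divff // /logb ?ln1 ?mul0r ?mulr0 //.
  apply: eq_bigl => w; apply: andb_idl => /eqP Yw.
  by apply/eqP/detXY; rewrite Yw.
rewrite big_pred0 ?mul0r // => w; apply/andP => -[/eqP Xw /eqP Yw].
by move/eqP: neq_a; apply; rewrite -Xw; apply: detXY; rewrite Yw.
Qed.

(** Where [Y] has non-zero mass, the conditional law of [X] is its law; the weights sum to 1. *)
Lemma cond_entropy_indep :
  \sum_w P w = 1 ->
  (forall a y, \sum_(w | (X w == a) && (Y w == y)) P w
     = pmf_of P X a * \sum_(w | Y w == y) P w) ->
  cond_entropy b P X Y = entropy b P X.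
Proof.
move=> P1 indep; rewrite -[RHS]mul1r -P1 (partition_big Y xpredT) //= mulr_suml.
apply: eq_bigr => y _; set p := \sum_(w | _) _.
have [->|p_neq0] := eqVneq p 0; first by rewrite !mul0r.
congr (_ * - _); apply: eq_bigr => a _.
by rewrite pmf_cond_pmf indep mulfK.
Qed.

End Entropies.

(** * Secrecy and decoders from properties of the encoding map *)

Section Schemes.
Variables (R : realType) (Q : finType) (n k : nat) (S : scheme R Q n k).
Variable m0 : {ffun 'I_k -> Q}.
Implicit Types I : {set 'I_n}.

Let M : R := #|{ffun 'I_k -> Q}|%:R.

Let M_neq0 : M != 0.
Proof. by rewrite pnatr_eq0 -lt0n; apply/card_gt0P; exists m0. Qed.

Lemma sum_secret : \sum_(m : {ffun 'I_k -> Q}) M^-1 = 1.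
Proof. by rewrite sumr_const -[LHS]mulr_natl divff. Qed.

Lemma sum_jointP : \sum_w jointP (S := S) w = 1.
Proof.
rewrite -(pair_bigA _ (fun m w => M^-1 * keyP (s := S) w)) /= -sum_secret.
by apply: eq_bigr => m _; rewrite -mulr_sumr keyP_sum1 mulr1.
Qed.

(** The law [p] of the shares given the message may be arbitrary; what matters is that it does not
    depend on the message. *)
Lemma secret_given_uniform I (p : {ffun {i : 'I_n | i \in I} -> Q} -> R) :
  (forall m y, \sum_(w | shares_rv (S := S) I (m, w) == y) keyP w = p y) ->
  H_secret_given S I = H_secret S.
Proof.
move=> sum_p; apply: cond_entropy_indep sum_jointP _ => a y.
(* [B] stays free: [pred1 a] gives the joint mass and [predT] the marginal of the shares. *)
have jointE (B : pred {ffun 'I_k -> Q}) :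
    \sum_(w | B (secret_rv w) && (shares_rv I w == y)) jointP (S := S) w
      = (\sum_(m | B m) M^-1) * p y.
  transitivity (\sum_(m | B m) \sum_(w | shares_rv (S := S) I (m, w) == y)
      M^-1 * keyP (s := S) w).
    by rewrite pair_big_dep.
  by rewrite mulr_suml; apply: eq_bigr => m _; rewrite -mulr_sumr sum_p.
rewrite (jointE (pred1 a)) (jointE predT) sum_secret mul1r.
rewrite big_pred1_eq; congr (_ * _).
transitivity (\sum_(m | m == a) \sum_w M^-1 * keyP (s := S) w).
  by rewrite big_pred1_eq -mulr_sumr keyP_sum1 mulr1.
by rewrite pair_big_dep; apply: eq_bigl => w; rewrite andbT.
Qed.

(** Decoding is exhaustive search for a message compatible, under some key, with what was received;
    injectivity makes it unique. *)
Lemma decoder_exists I (T : finType) (f : Q -> T) : (#|T| <= #|Q|)%N ->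
  (forall m m' (w w' : key S),
     (forall i, i \in I -> f (encode m w i) = f (encode m' w' i)) -> m = m') ->
  exists D : decoder S I,
    comm_overhead D = #|I|%:R * logb #|Q|%:R #|T|%:R - k%:R.
Proof.
move=> leTQ f_inj; pose IT := {i : 'I_n | i \in I}.
pose matches (y : IT -> T) m := [exists w : key S,
  [forall i : IT, f (encode m w (val i)) == y i]].
(* The default [m0] is reached only on inputs that no encoding produces. *)
pose dec y := odflt m0 [pick m | matches y m].
have decK m (w : key S) : 0 < keyP w ->
    dec (fun i => f (encode m w (val i))) = m.
  move=> _; rewrite /dec; case: pickP => [m' /existsP[w' /forallP eq_f]|].
    apply: f_inj => i iI; exact/eqP/(eq_f (Sub i iI)).
  by move/(_ m)/existsP => []; exists w; apply/forallP => i.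
exists (@Decoder R Q n k S I (fun=> T) (fun=> f) dec (fun=> leTQ) decK).
by rewrite /comm_overhead /= sumr_const card_sig mulr_natl.
Qed.

End Schemes.

Lemma logb_exp (R : realType) (q a b : nat) : (1 < q)%N ->
  logb (q ^ b)%:R (q ^ a)%:R = a%:R / b%:R :> R.
Proof.
move=> q_gt1; have q_gt0 : (0 : R) < q%:R by rewrite ltr0n ltnW.
rewrite /logb !natrX !lnXn // -[_ *+ a]mulr_natr -[_ *+ b]mulr_natr.
by rewrite -mulf_div divff ?mul1r // gt_eqF // ln_gt0 // ltr1n.
Qed.

Theorem theorem3 (R : realType) (n k r z : nat) (hn1 : (1 <= n)%N)
    (hn : n = (k + r + z)%N) (hk : (1 <= k)%N)
    (F : finFieldType) (hF : (n * (k + r) < #|F|)%N)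
    (alpha : 'I_((k + r) * n) -> F) (alpha_inj : injective alpha)
    (alpha_neq0 : forall j, alpha j != 0) :
  [/\ rate_optimal (linear_scheme alpha hn R) r z,
      optimal_decoding_bandwidth (linear_scheme alpha hn R) z n
    & optimal_decoding_bandwidth (linear_scheme alpha hn R) z (n - r)%N].
Proof.
set S := linear_scheme alpha hn R.
have q_gt1 : (1 < #|F|)%N := card_finNzRing_gt1 F.
have cardQ : #|'rV[F]_(k + r)| = (#|F| ^ (k + r))%N by rewrite card_mx mul1n.
have kr_neq0 : (k + r)%:R != 0 :> R by rewrite pnatr_eq0 -lt0n addn_gt0 hk.
pose m0 : {ffun 'I_k -> 'rV[F]_(k + r)} := [ffun=> 0].
(* Serves both reliability and decoding from n - r nodes. *)
have reliableS (I : {set 'I_n}) m m' (w w' : key S) : #|I| = (n - r)%N ->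
    (forall i, i \in I -> encode m w i = encode m' w' i) -> m = m'.
  move=> cardI eq_c; apply: (@input_msg_inj F n k r z hn m m' w w').
  apply: (codeword_all_eq0 alpha_inj hn cardI) => i j jI.
  by apply: share_encode_eq; rewrite [in LHS](eq_c j jI).
split; [split|..].
- split=> [I cardI|I cardI].
    apply: cond_entropy_determined => -[m w] [m' w'] eq_c.
    apply: (reliableS I m m' w w' cardI) => i iI.
    by move/ffunP/(_ (Sub i iI)): eq_c; rewrite !ffunE.
  (* With q = [#|F|], keys and views of z shares both number q^((k+r)z), so injectivity suffices. *)
  have shares_bij m : bijective (fun w : key S => shares_rv (S := S) I (m, w)).
    apply: inj_card_bij; last first.
      rewrite card_ffun cardQ card_sig cardI card_prod !card_mx !mul1n.
      by rewrite -expnM -expnD mulnDl.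
    move=> w w' eq_c; apply: (@input_key_inj F n k r z hn m); apply/eqP.
    rewrite -subr_eq0; apply/eqP.
    apply: (codeword_keys_eq0 alpha_inj hn alpha_neq0 cardI) => [l lt_l|i j jI].
      by rewrite !mxE (input_same_msg hn m w w' lt_l) subrr.
    apply: share_encode_eq.
    by move/ffunP/(_ (Sub j jI)): eq_c; rewrite [LHS]ffunE [RHS]ffunE /= => ->.
  (* Each view comes from exactly one key, whatever the message. *)
  apply: (secret_given_uniform m0 (p := fun=> #|key S|%:R^-1)) => m y.
  have [g gK fK] := shares_bij m.
  rewrite (big_pred1 (g y)) // => w.
  by apply/eqP/eqP => [<-|->]; [rewrite gK | apply: fK].
- by rewrite hn !PoszD addrAC !addrK.
- move=> I cardI.
  have leT : (#|'rV[F]_k| <= #|'rV[F]_(k + r)|)%N.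
    by rewrite cardQ card_mx mul1n leq_exp2l ?leq_addr.
  have [m m' w w' eq_c|D overheadD] :=
      @decoder_exists R _ n k S m0 I _ lsubmx leT.
    apply: (@input_msg_inj F n k r z hn m m' w w').
    apply: (codeword_low_eq0 alpha_inj) => i j lt_ik.
    apply: share_encode_eq.
    have jI : j \in I.
      suff /eqP -> : I == setT by rewrite inE.
      by rewrite eqEcard subsetT cardsT card_ord cardI /=.
    have /rowP/(_ (Ordinal lt_ik)) := eq_c j jI; rewrite !mxE.
    by have -> : lshift r (Ordinal lt_ik) = i by apply: val_inj.
  exists D; rewrite overheadD cardI cardQ card_mx mul1n logb_exp //.
  (* As n - z = k + r, the overhead nk/(k+r) - k equals kz/(k+r). *)
  have -> : n%:R = (k + r)%:R + z%:R :> R by rewrite {1}hn natrD.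
  rewrite addrK mulrDl [_ * (k%:R / _)]mulrC divfK ?kr_neq0 //.
  by rewrite addrAC subrr add0r natrM mulrA [z%:R * _]mulrC.
- move=> I cardI.
  (* Sending full shares costs (k + z) - k = z, which is kz/(n-r-z) because n - r - z = k > 0. *)
  have [m m' w w'|D overheadD] := @decoder_exists R _ n k S m0 I _ id (leqnn _).
    exact: reliableS.
  exists D; rewrite overheadD cardI cardQ logb_exp // divff // mulr1.
  have -> : (n - r = k + z)%N by rewrite {1}hn addnAC addnK.
  by rewrite natrD addrAC subrr add0r addrK natrM mulrAC divff ?mul1r //
    pnatr_eq0 -lt0n.
Qed.
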